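(* Let $d\ge1$ and $l\ge2$ be integers. There exists a function $\beta\in C^\infty(\mathbb{R},\mathbb{R})$ with $\sup_{t\in\mathbb{R}}|\partial_t^\ell\beta(t)|<+\infty$ for all $\ell\in\mathbb{N}_0$, such that the system $$\ddot q_1+q_1^{2l-1}=\beta(t),\qquad \ddot q_j+q_j^{2l-1}=0,\quad 2\le j\le d,$$ possesses an unbounded solution $q(t)$. Moreover, there exist $C_1,C_2>0$ such that, with $p(t)=\dot q(t)$, $$C_1\,[\log(2+t)]^2\ \le\ E\big(q(t),p(t)\big)\ \le\ C_2\,[\log(2+t)]^2,\qquad\forall t\ge0.$$
   Context: $E(q,p):=\frac{|p|^2}{2}+W_l(q)$ for $q,p\in\mathbb{R}^d$, where $W_l(q):=\frac{1}{2l}\sum_{j=1}^d q_j^{2l}$. The system is the system of Hamiltonian equations of motion of $H(t,q,p)=\frac{|p|^2}{2}+W_l(q)-\beta(t)q_1$ (the sign of $\beta$ being immaterial). *)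

(* Defs.v *)
From Stdlib Require Import Reals.
From Coquelicot Require Import Coquelicot.
From mathcomp Require Import all_boot.

Set Implicit Arguments.
Unset Strict Implicit.
Unset Printing Implicit Defensive.

Local Open Scope R_scope.

(* Vectors of R^d are functions 'I_d -> R: the coordinate q_1 is the one at
   index 0, and q_2, ..., q_d are those at nonzero indices. *)

Definition sqnorm (d : nat) (x : 'I_d -> R) : R :=
  \big[Rplus/0]_(j < d) (x j ^ 2).

Definition norm (d : nat) (x : 'I_d -> R) : R := sqrt (sqnorm x).

Definition W (d l : nat) (q : 'I_d -> R) : R :=
  / (2 * INR l) * \big[Rplus/0]_(j < d) (q j ^ (2 * l)).

Definition E (d l : nat) (q p : 'I_d -> R) : R := sqnorm p / 2 + W l q.

Definition smooth (f : R -> R) : Prop :=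
  forall (n : nat) (t : R), ex_derive_n f n t.

Definition bounded_fun (f : R -> R) : Prop :=
  exists M : R, forall t : R, Rabs (f t) <= M.

Definition velocity (d : nat) (q : R -> 'I_d -> R) (t : R) : 'I_d -> R :=
  fun j => Derive (fun s => q s j) t.

(* [ex_derive_n f 2 t] only says that the total function [Derive f] is
   differentiable at t, so differentiability of f is required separately. *)
Definition solution (d l : nat) (beta : R -> R) (q : R -> 'I_d -> R) : Prop :=
  forall (j : 'I_d) (t : R),
    [/\ ex_derive (fun s => q s j) t,
        ex_derive_n (fun s => q s j) 2 t
      & Derive_n (fun s => q s j) 2 t + q t j ^ (2 * l - 1)
        = if nat_of_ord j is O then beta t else 0].

Definition unbounded (d : nat) (q : R -> 'I_d -> R) : Prop :=
  ~ exists M : R, forall t : R, norm (q t) <= M.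

(* Main.v *)
Require Import Defs.
From Stdlib Require Import Reals Lra Lia.
From Coquelicot Require Import Coquelicot.
From mathcomp Require Import all_boot.

Local Open Scope R_scope.

(** The force is read off from the motion: one picks an oscillation whose
    amplitude grows logarithmically and declares the defect of the free
    equation to be beta. Write l = m + 1.

    Let x solve the free equation x'' = - x ^ (2m+1), with energy
    x'^2 / 2 + x^(2l) / (2l) = 1 / (2l). Put L t = ln (3 + t^2),
    A = L^(1/l) and q = A * (x o Th), where Th' = A^m. Since s |-> a x(a^m s)
    solves the free equation for every constant a, and here a is replaced by
    the slowly varying A, all that is left over is
      beta = q'' + q^(2m+1) = A'' X + (l+1) A^m A' Y,
    with X = x o Th and Y = x' o Th: each term has a derivative of A as a
    factor. These derivatives decay like 1/t up to powers of L, whereas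
    differentiating X or Y only costs a factor A^m, a power of L. So beta and
    all its derivatives decay.

    This bookkeeping is done algebraically. The polynomials in A, 1/L,
    u = 1/(3+t^2), v = t/(3+t^2), X and Y are stable under d/dt
    ([poly_in_derive]) and grow at most like a power of L
    ([poly_in_growth]). The ideal generated by u and v is stable under d/dt as
    well ([decaying_derive]), and its elements are bounded
    ([decaying_bounded]), because L^n is negligible compared with exp L =
    1/u. It contains A', hence A'' and beta.

    The energy of q is that of x multiplied by A^(2l) = L^2, up to the term
    A' X in the velocity, whose square is at most 1/(6l); and L t is
    comparable with ln (2 + t) for t >= 0. The solution is unbounded because x
    takes the value 1 at arbitrarily late times, when q = A.

    The function x is found without a general existence theorem for
    differential equations ([oscillator]): with x = sin phi, conservation of
    energy becomes the first order equation phi' = g(phi), with g smooth and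
    positive, which is solved by inverting a primitive of 1/g
    ([expanding_inverse]). *)

(** * Calculus on the real line *)

Lemma mean_value (f f' : R -> R) (hf : forall t, is_derive f t (f' t)) (a b : R) :
  a <= b -> exists c, f b - f a = f' c * (b - a).
Proof.
move=> hab.
have [||c [_ hc]] := MVT_gen f a b f'.
- by move=> x _; apply: hf.
- move=> x _; apply/continuity_pt_filterlim.
  by apply: (ex_derive_continuous (V := R_NormedModule)); exists (f' x); apply: hf.
- by exists c.
Qed.

(** A derivative bounded below by 1 makes f expand distances, hence makes it a
    bijection of R with a 1-Lipschitz inverse. This contraction lets the
    estimate for the difference quotients of f serve unchanged for those of
    the inverse. *)
Lemma expanding_inverse (f f' : R -> R) :
  (forall x, is_derive f x (f' x)) -> (forall x, 1 <= f' x) ->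
  exists h : R -> R,
    (forall y, f (h y) = y) /\ (forall y, is_derive h y (/ f' (h y))).
Proof.
move=> hf hf1.
have expand : forall a b, a <= b -> b - a <= f b - f a.
  move=> a b hab; have [c ->] := mean_value f f' hf a b hab.
  by have := hf1 c; nra.
have cont : continuity f.
  move=> x; apply/continuity_pt_filterlim.
  by apply: (ex_derive_continuous (V := R_NormedModule)); exists (f' x); apply: hf.
have onto : forall y, {x | f x = y}.
  move=> y; set r := Rabs (y - f 0).
  have r0 : 0 <= r by apply: Rabs_pos.
  have hup := expand 0 r r0.
  have hdown : 0 - - r <= f 0 - f (- r) by apply: expand; lra.
  have [h1 h2] : - r <= y - f 0 <= r.
    have a1 := Rle_abs (y - f 0); have a2 := Rle_abs (- (y - f 0)).
    by rewrite Rabs_Ropp in a2; rewrite /r; lra.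
  have [|x [_ hx]] := IVT_gen f (- r) r y cont; last by exists x.
  by rewrite Rmin_left ?Rmax_right; lra.
pose h y := proj1_sig (onto y).
have fh y : f (h y) = y by apply: (proj2_sig (onto y)).
have lip : forall y z, Rabs (h z - h y) <= Rabs (z - y).
  move=> y z; rewrite -{2}(fh y) -{2}(fh z).
  case: (Rle_lt_dec (h y) (h z)) => H.
  - by have := expand _ _ H => H1; rewrite !Rabs_pos_eq; lra.
  - have := expand _ _ (Rlt_le _ _ H) => H1.
    by rewrite Rabs_minus_sym (Rabs_minus_sym (f _)) !Rabs_pos_eq; lra.
exists h; split=> // y.
apply/is_derive_Reals => eps heps.
have /is_derive_Reals/(_ eps heps) [del hdel] := hf (h y).
exists del => k k0 hk.
set j := h (y + k) - h y.
have fj : f (h y + j) - f (h y) = k.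
  by rewrite /j; replace (h y + (h (y + k) - h y)) with (h (y + k)) by ring; rewrite !fh; ring.
have j0 : j <> 0 by move=> jz; apply: k0; rewrite -fj jz Rplus_0_r; ring.
have hj : Rabs j < del.
  apply: Rle_lt_trans hk; apply: Rle_trans (lip y (y + k)) _.
  by apply: Req_le; congr Rabs; ring.
have := hdel j j0 hj; rewrite fj.
set Q := k / j; set D := f' (h y) => hQ.
have D1 : 1 <= D by apply: hf1.
have Q1 : 1 <= Q.
  rewrite /Q -fj; case: (Rle_lt_dec 0 j) => Hj.
    have := expand (h y) (h y + j) ltac:(lra) => H.
    by apply/(Rle_div_r _ _ j); lra.
  have := expand (h y + j) (h y) ltac:(lra) => H.
  replace ((f (h y + j) - f (h y)) / j) with ((f (h y) - f (h y + j)) / (- j)) by (field; lra).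
  by apply/(Rle_div_r _ _ (- j)); lra.
(* both quotients are at least 1, so passing to inverses contracts *)
have -> : j / k - / D = (D - Q) / (Q * D).
  by rewrite /Q; field; repeat split; lra.
have QD : 1 <= Q * D by nra.
rewrite /Rdiv Rabs_mult Rabs_inv (Rabs_pos_eq (Q * D)); last lra.
apply: Rle_lt_trans hQ.
rewrite (Rabs_minus_sym Q).
apply/(Rle_div_l _ _ (Q * D)); first lra.
by have := Rabs_pos (D - Q); nra.
Qed.

Lemma is_derive_antiderivative (f : R -> R) :
  (forall t, continuous f t) ->
  forall t, is_derive (fun s => RInt f 0 s) t (f t).
Proof.
move=> hf t.
apply: (is_derive_RInt f (fun s => RInt f 0 s) 0 t) => //.
apply: filter_forall => s.
apply: RInt_correct; apply: ex_RInt_continuous => z _; apply: hf.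
Qed.

(** * The free oscillator *)

Lemma pow_muln x m n : x ^ (m * n) = (x ^ m) ^ n.
Proof. exact: pow_mult. Qed.

(** The Horner form of 1 + z + ... + z^m. *)
Fixpoint geo (m : nat) (z : R) : R :=
  if m is k.+1 then 1 + z * geo k z else 1.

Fixpoint geo' (m : nat) (z : R) : R :=
  if m is k.+1 then geo k z + z * geo' k z else 0.

Lemma is_derive_geo m z : is_derive (geo m) z (geo' m z).
Proof.
elim: m => [|m IHm] /=; first by apply: is_derive_const.
auto_derive; first by exists (geo' m z).
by rewrite (is_derive_unique _ _ _ IHm); ring.
Qed.

Lemma geoE m z : (1 - z) * geo m z = 1 - z ^ m.+1.
Proof.
elim: m => [|m IHm] /=; first ring.
replace ((1 - z) * (1 + z * geo m z)) with (1 - z + z * ((1 - z) * geo m z)) by ring.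
by rewrite IHm /=; ring.
Qed.

(** Up to sign, the derivative of [geoE] with respect to z. *)
Lemma geo'E m z : geo m z - (1 - z) * geo' m z = INR m.+1 * z ^ m.
Proof.
elim: m => [|m IHm]; first by rewrite /=; ring.
have hg := geoE m z.
rewrite !S_INR -?tech_pow_Rmult in IHm hg *.
change (geo m.+1 z) with (1 + z * geo m z).
change (geo' m.+1 z) with (geo m z + z * geo' m z).
replace (1 + z * geo m z - (1 - z) * (geo m z + z * geo' m z))
  with (1 - (1 - z) * geo m z + z * (geo m z - (1 - z) * geo' m z)) by ring.
by rewrite hg IHm; ring.
Qed.

Lemma geo_bounds m z : 0 <= z <= 1 -> 1 <= geo m z <= INR m.+1.
Proof.
move=> hz; elim: m => [|m IHm]; first by rewrite /=; lra.
change (geo m.+1 z) with (1 + z * geo m z).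
by rewrite (S_INR m.+1); nra.
Qed.

(** With x = sin phi, the energy identity x'^2 = (1 - x^(2l)) / l reads
    cos^2 phi * phi'^2 = (1 - sin^(2l) phi) / l. The factor cos^2 phi, which
    vanishes at the turning points, divides the right-hand side, and what
    remains is phi' = g(phi) with g^2 = (1 + sin^2 phi + ... + sin^(2m) phi) / l
    in ]0, 1]. Hence phi is the inverse of a primitive G of 1/g, and the
    maximum x = 1 is reached at the times G (pi/2 + 2 k pi). *)
Lemma oscillator (m : nat) :
  exists x y : R -> R,
    [/\ forall s, is_derive x s (y s),
        forall s, is_derive y s (- x s ^ (2 * m).+1),
        forall s, y s ^ 2 + x s ^ (2 * m.+1) / INR m.+1 = / INR m.+1
      & forall T, exists2 s, T < s & x s = 1].
Proof.
set l := INR m.+1.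
have l1 : 1 <= l.
  by rewrite /l S_INR; have := pos_INR m; lra.
pose P y := geo m (sin y ^ 2) / l.
have sin2 y : 0 <= sin y ^ 2 <= 1.
  by have := sin2_cos2 y; rewrite /Rsqr; nra.
have P0 y : 0 < P y.
  have := geo_bounds m _ (sin2 y) => -[h1 h2].
  by apply: Rdiv_lt_0_compat; lra.
have P1 y : P y <= 1.
  have := geo_bounds m _ (sin2 y) => -[h1 h2].
  by apply/Rle_div_l; rewrite ?Rmult_1_l //; lra.
pose P' y := geo' m (sin y ^ 2) * (2 * sin y * cos y) / l.
have dP y : is_derive P y (P' y).
  rewrite /P /P'; auto_derive.
    by exists (geo' m (sin y ^ 2)); apply: is_derive_geo.
  have -> : sin y * (sin y * 1) = sin y ^ 2 by [].
  rewrite (is_derive_unique _ _ _ (is_derive_geo m (sin y ^ 2))).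
  by field; lra.
pose g y := sqrt (P y).
have g0 y : 0 < g y by apply: sqrt_lt_R0.
have gg y : g y * g y = P y by apply: sqrt_sqrt; apply: Rlt_le.
have dg y : is_derive g y (P' y / (2 * g y)).
  rewrite /g; auto_derive.
    by split; [exists (P' y)|split].
  by rewrite (is_derive_unique _ _ _ (dP y)); field; apply: Rgt_not_eq; apply: g0.
pose G y := RInt (fun u => / g u) 0 y.
have dG y : is_derive G y (/ g y).
  apply: is_derive_antiderivative => u.
  apply: (ex_derive_continuous (V := R_NormedModule)).
  auto_derive; split; first by exists (P' u / (2 * g u)).
  by split=> //; apply: Rgt_not_eq; apply: g0.
have dG1 y : 1 <= / g y.
  rewrite -Rinv_1; apply: Rinv_le_contravar => //.
  by rewrite -sqrt_1; apply: sqrt_le_1_alt.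
have [phi [Gphi dphi]] := expanding_inverse G (fun y => / g y) dG dG1.
have dphi' s : is_derive phi s (g (phi s)).
  by rewrite -(Rinv_inv (g (phi s))).
exists (fun s => sin (phi s)), (fun s => cos (phi s) * g (phi s)); split.
- move=> s; auto_derive; first by exists (g (phi s)).
  by rewrite (is_derive_unique _ _ _ (dphi' s)); ring.
- move=> s; auto_derive.
    split; first by exists (g (phi s)).
    by split; [exists (P' (phi s) / (2 * g (phi s)))|split; [exists (g (phi s))|]].
  rewrite (is_derive_unique _ _ _ (dphi' s)) (is_derive_unique _ _ _ (dg (phi s))).
  set r := phi s.
  (* (cos g)' g = - sin g^2 + cos (g^2)'/2, a multiple of
     geo - (1 - z) geo' at z = sin^2 *)
  have h := geo'E m (sin r ^ 2); rewrite -/l in h.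
  have hc : cos r * cos r = 1 - sin r ^ 2.
    by have := sin2_cos2 r; rewrite /Rsqr; lra.
  have g0r := g0 r; have ggr := gg r.
  have -> : sin r ^ (2 * m).+1
            = sin r * (geo m (sin r ^ 2) - (1 - sin r ^ 2) * geo' m (sin r ^ 2)) / l.
    by rewrite h -tech_pow_Rmult pow_muln; field; lra.
  have -> : 1 * g r * - sin r * g r + cos r * (1 * g r * (P' r / (2 * g r)))
     = - sin r * (g r * g r) + cos r * P' r / 2 by field; lra.
  rewrite ggr /P /P' -hc; field; lra.
- move=> s; set r := phi s.
  have hc : cos r * cos r = 1 - sin r ^ 2.
    by have := sin2_cos2 r; rewrite /Rsqr; lra.
  have -> : (cos r * g r) ^ 2 = (cos r * cos r) * (g r * g r) by ring.
  rewrite hc gg pow_muln /P.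
  have -> : (1 - sin r ^ 2) * (geo m (sin r ^ 2) / l) = (1 - (sin r ^ 2) ^ m.+1) / l.
    by rewrite -(geoE m (sin r ^ 2)); field; lra.
  by field; lra.
- move=> T.
  have phiG y : phi (G y) = y.
    have inj a b : a < b -> G a < G b.
      move=> hab; have [c] := mean_value G _ dG a b (Rlt_le _ _ hab).
      by have := dG1 c; nra.
    by case: (Rtotal_order (phi (G y)) y) => [/inj|[|/inj]] //; rewrite Gphi; lra.
  have [k hk] := nfloor_ex (Rabs T) (Rabs_pos T).
  set y := PI / 2 + 2 * INR k.+1 * PI.
  have y0 : Rabs T < y.
    have := PI2_1; have := pos_INR k; rewrite /y S_INR; nra.
  exists (G y); last by rewrite phiG /y sin_period sin_PI2.
  have [c] := mean_value G _ dG 0 y ltac:(have := Rabs_pos T; lra).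
  have -> : G 0 = 0 by rewrite /G RInt_point.
  have := dG1 c; have := Rle_abs T; have := Rabs_pos T; nra.
Qed.

(** * Classes of functions stable under differentiation *)

Definition has_derivative_in (P : (R -> R) -> Prop) (f : R -> R) : Prop :=
  exists2 f', P f' & forall t, is_derive f t (f' t).

Lemma smooth_bounded_of_stable (P : (R -> R) -> Prop) :
  (forall f, P f -> has_derivative_in P f) ->
  (forall f, P f -> bounded_fun f) ->
  forall f, P f -> smooth f /\ forall n, bounded_fun (Derive_n f n).
Proof.
move=> dP bP f Pf.
have H n : exists2 g, P g & forall t, Derive_n f n t = g t.
  elim: n => [|n [g Pg fg]]; first by exists f.
  have [g' Pg' dg] := dP g Pg.
  exists g' => // t /=; rewrite (Derive_ext _ _ _ fg).
  exact: is_derive_unique.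
split.
- case=> [|n] t //=; have [g Pg fg] := H n.
  apply: (ex_derive_ext g) => [s|]; first by rewrite fg.
  by have [g' _ dg] := dP g Pg; exists (g' t).
- move=> n; have [g Pg fg] := H n; have [M hM] := bP g Pg.
  by exists M => t; rewrite fg.
Qed.

Inductive poly_in (gens : list (R -> R)) : (R -> R) -> Prop :=
| poly_in_const c : poly_in gens (fun=> c)
| poly_in_gen f : List.In f gens -> poly_in gens f
| poly_in_add f g :
    poly_in gens f -> poly_in gens g -> poly_in gens (fun t => f t + g t)
| poly_in_mul f g :
    poly_in gens f -> poly_in gens g -> poly_in gens (fun t => f t * g t).

Lemma poly_in_pow gens f n :
  poly_in gens f -> poly_in gens (fun t => f t ^ n).
Proof.
move=> hf; elim: n => [|n IHn] /=; first exact: poly_in_const.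
exact: poly_in_mul.
Qed.

Lemma is_derive_add (f g : R -> R) f' g' t :
  is_derive f t f' -> is_derive g t g' -> is_derive (fun s => f s + g s) t (f' + g').
Proof. exact: (is_derive_plus f g). Qed.

Lemma is_derive_mul (f g : R -> R) f' g' t :
  is_derive f t f' -> is_derive g t g' ->
  is_derive (fun s => f s * g s) t (f' * g t + f t * g').
Proof. by move=> hf hg; apply: (is_derive_mult f g) => //; apply: Rmult_comm. Qed.

Lemma poly_in_derive gens :
  (forall f, List.In f gens -> has_derivative_in (poly_in gens) f) ->
  forall f, poly_in gens f -> has_derivative_in (poly_in gens) f.
Proof.
move=> hgens f; elim=> {f} [c|f /hgens //|f g pf [f' pf' hf] pg [g' pg' hg]
                           |f g pf [f' pf' hf] pg [g' pg' hg]].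
- exists (fun=> 0); first exact: poly_in_const.
  by move=> t; apply: is_derive_const.
- exists (fun t => f' t + g' t); first exact: poly_in_add.
  by move=> t; apply: is_derive_add.
- exists (fun t => f' t * g t + f t * g' t).
    by apply: poly_in_add; apply: poly_in_mul.
  by move=> t; apply: is_derive_mul.
Qed.

Lemma poly_in_growth gens (L : R -> R) :
  (forall t, 1 <= L t) ->
  (forall f, List.In f gens -> forall t, Rabs (f t) <= L t) ->
  forall f, poly_in gens f ->
    exists C N, forall t, Rabs (f t) <= C * L t ^ N.
Proof.
move=> L1 hgens f; elim=> {f} [c|f /hgens hf|f g _ [C [N hf]] _ [C' [N' hg]]
                           |f g _ [C [N hf]] _ [C' [N' hg]]].
- by exists (Rabs c), 0%N => t /=; lra.
- by exists 1, 1%N => t; rewrite pow_1 Rmult_1_l.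
- exists (Rabs C + Rabs C'), (N + N')%N => t.
  apply: Rle_trans (Rabs_triang _ _) _.
  have hN : L t ^ N <= L t ^ (N + N') by apply: Rle_pow => //; apply/leP; apply: leq_addr.
  have hN' : L t ^ N' <= L t ^ (N + N') by apply: Rle_pow => //; apply/leP; apply: leq_addl.
  have p1 := pow_R1_Rle (L t) N (L1 t); have p2 := pow_R1_Rle (L t) N' (L1 t).
  have := hf t; have := hg t.
  have := Rle_abs C; have := Rle_abs C'; have := Rabs_pos C; have := Rabs_pos C'.
  by nra.
- exists (C * C'), (N + N')%N => t.
  rewrite Rabs_mult pow_add.
  have -> : C * C' * (L t ^ N * L t ^ N') = (C * L t ^ N) * (C' * L t ^ N') by ring.
  by apply: Rmult_le_compat => //; apply: Rabs_pos.
Qed.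

Lemma exp_nat_mul n x : exp (INR n * x) = exp x ^ n.
Proof.
elim: n => [|n IHn]; first by rewrite Rmult_0_l exp_0.
by rewrite S_INR Rmult_plus_distr_r Rmult_1_l exp_plus IHn /=; ring.
Qed.

Lemma pow_le_exp n : exists C, forall x, 0 <= x -> x ^ n <= C * exp x.
Proof.
set k := INR n.+1.
have k1 : 1 <= k by rewrite /k S_INR; have := pos_INR n; lra.
(* exp x = exp (x / k) ^ k dominates (1 + x / k) ^ k *)
exists (k ^ n.+1) => x x0.
have hx : 0 <= x / k by apply: Rdiv_le_0_compat; lra.
have base : 1 + x / k <= exp (x / k) by apply: exp_ineq1_le.
have -> : exp x = exp (x / k) ^ n.+1.
  by rewrite -exp_nat_mul -/k; congr exp; field; lra.
rewrite -Rpow_mult_distr.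
have h1 : 1 + x <= k * exp (x / k).
  have : k * (1 + x / k) = k + x by field; lra.
  by nra.
apply: (Rle_trans _ ((1 + x) ^ n)); first by apply: pow_incr; lra.
apply: (Rle_trans _ ((1 + x) ^ n.+1)); first by apply: Rle_pow; [lra|lia].
by apply: pow_incr; lra.
Qed.

(** * Logarithmic growth and rational decay *)

Definition L (t : R) : R := ln (3 + t ^ 2).
Definition u (t : R) : R := / (3 + t ^ 2).
Definition v (t : R) : R := t / (3 + t ^ 2).

Lemma L_ge1 t : 1 <= L t.
Proof.
rewrite -{1}(ln_exp 1) /L.
by apply: ln_le; [apply: exp_pos|have := exp_le_3; nra].
Qed.

Lemma is_derive_L t : is_derive L t (2 * v t).
Proof. by rewrite /L /v; auto_derive; [nra|field; nra]. Qed.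

Lemma is_derive_u t : is_derive u t (- (2) * u t * v t).
Proof. by rewrite /u /v; auto_derive; [nra|field; nra]. Qed.

Lemma is_derive_v t : is_derive v t (u t + - (2) * v t * v t).
Proof. by rewrite /u /v; auto_derive; [nra|field; nra]. Qed.

Lemma v_sq t : v t ^ 2 <= / 12.
Proof.
rewrite /v; have h : 0 < 3 + t ^ 2 by nra.
have -> : (t / (3 + t ^ 2)) ^ 2 = t ^ 2 / (3 + t ^ 2) ^ 2 by field; nra.
apply/Rle_div_l; first by nra.
by have := pow2_ge_0 (t ^ 2 - 3); nra.
Qed.

Lemma u_bounds t : 0 < u t <= 1.
Proof.
rewrite /u; split; first by apply: Rinv_0_lt_compat; nra.
by rewrite -Rinv_1; apply: Rinv_le_contravar; nra.
Qed.

Lemma v_sq_le_u t : v t ^ 2 <= u t.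
Proof.
rewrite /v /u; have h : 0 < 3 + t ^ 2 by nra.
have -> : (t / (3 + t ^ 2)) ^ 2 = t ^ 2 * / (3 + t ^ 2) * / (3 + t ^ 2) by field; nra.
have i0 : 0 < / (3 + t ^ 2) by apply: Rinv_0_lt_compat.
have i1 : (3 + t ^ 2) * / (3 + t ^ 2) = 1 by field; nra.
by nra.
Qed.

Lemma u_L_pow_bounded n : exists C, forall t, u t * L t ^ n <= C.
Proof.
have [C hC] := pow_le_exp n.
exists C => t; have L1 := L_ge1 t; have u0 := u_bounds t.
have := hC (L t) ltac:(lra).
have -> : exp (L t) = / u t by rewrite /L exp_ln /u ?Rinv_inv //; nra.
move=> H; replace C with (u t * (C * / u t)) by (field; lra).
by apply: Rmult_le_compat_l; lra.
Qed.

(** The square of v L^n is at most u L^(2n), which is bounded. *)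
Lemma v_L_pow_bounded n : exists C, forall t, Rabs (v t) * L t ^ n <= C.
Proof.
have [C hC] := u_L_pow_bounded (n + n).
exists (1 + C) => t; have := hC t; rewrite pow_add => H.
have := v_sq_le_u t; rewrite -(pow2_abs (v t)) => Hv.
have p := pow_R1_Rle (L t) n (L_ge1 t).
set a := Rabs (v t) in Hv *; set b := L t ^ n in H p *.
have : (a * b) ^ 2 <= u t * (b * b) by rewrite Rpow_mult_distr; nra.
by have := pow2_ge_0 (a * b - 1); nra.
Qed.

(** The ideal generated by u and v in the ring of polynomials in [gens]. *)
Definition decaying (gens : list (R -> R)) (f : R -> R) : Prop :=
  exists g h, [/\ poly_in gens g, poly_in gens h
                & forall t, f t = u t * g t + v t * h t].

Lemma decaying_poly gens f h :
  decaying gens f -> poly_in gens h -> decaying gens (fun t => f t * h t).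
Proof.
case=> a [b [pa pb fE]] ph.
exists (fun t => a t * h t), (fun t => b t * h t); split.
- exact: poly_in_mul.
- exact: poly_in_mul.
- by move=> t; rewrite fE; ring.
Qed.

Lemma decaying_add gens f g :
  decaying gens f -> decaying gens g -> decaying gens (fun t => f t + g t).
Proof.
case=> a [b [pa pb fE]] [a' [b' [pa' pb' gE]]].
exists (fun t => a t + a' t), (fun t => b t + b' t); split.
- exact: poly_in_add.
- exact: poly_in_add.
- by move=> t; rewrite fE gE; ring.
Qed.

(** The ideal is stable because u' = - 2 u v and v' = u - 2 v^2 belong to it. *)
Lemma decaying_derive gens :
  (forall f, List.In f gens -> has_derivative_in (poly_in gens) f) ->
  List.In v gens ->
  forall f, decaying gens f -> has_derivative_in (decaying gens) f.
Proof.
move=> gens_derive gens_v f; case=> g [h [pg ph fE]].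
have [g' pg' dg] := poly_in_derive gens gens_derive g pg.
have [h' ph' dh] := poly_in_derive gens gens_derive h ph.
have pv := poly_in_gen gens v gens_v.
exists (fun t => u t * (-2 * v t * g t + g' t + h t) + v t * (-2 * v t * h t + h' t)).
  exists (fun t => -2 * v t * g t + g' t + h t), (fun t => -2 * v t * h t + h' t).
  split=> //;
    by repeat first [assumption|apply: poly_in_const|apply: poly_in_add|apply: poly_in_mul].
move=> t; apply: (is_derive_ext (fun t => u t * g t + v t * h t)) => [s|].
  by rewrite fE.
have -> : u t * (-2 * v t * g t + g' t + h t) + v t * (-2 * v t * h t + h' t)
  = (- (2) * u t * v t * g t + u t * g' t) + ((u t + - (2) * v t * v t) * h t + v t * h' t).
  ring.
apply: is_derive_add; apply: is_derive_mul => //.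
- exact: is_derive_u.
- exact: is_derive_v.
Qed.

Lemma decaying_bounded gens :
  (forall f, List.In f gens -> forall t, Rabs (f t) <= L t) ->
  forall f, decaying gens f -> bounded_fun f.
Proof.
move=> gens_le_L f; case=> g [h [pg ph fE]].
have [C [N hg]] := poly_in_growth gens L L_ge1 gens_le_L g pg.
have [C' [N' hh]] := poly_in_growth gens L L_ge1 gens_le_L h ph.
have [K hK] := u_L_pow_bounded N.
have [K' hK'] := v_L_pow_bounded N'.
exists (Rabs C * K + Rabs C' * K') => t; rewrite fE.
apply: Rle_trans (Rabs_triang _ _) _; rewrite (Rabs_mult (u t)) (Rabs_mult (v t)).
have u0 := u_bounds t; rewrite (Rabs_pos_eq (u t)); last lra.
have pN := pow_R1_Rle (L t) N (L_ge1 t); have pN' := pow_R1_Rle (L t) N' (L_ge1 t).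
apply: Rplus_le_compat.
- apply: (Rle_trans _ (u t * (Rabs C * L t ^ N))).
    apply: Rmult_le_compat_l; first lra.
    by have := hg t; have := Rle_abs C; nra.
  by have := hK t; have := Rabs_pos C; nra.
- apply: (Rle_trans _ (Rabs (v t) * (Rabs C' * L t ^ N'))).
    apply: Rmult_le_compat_l; first exact: Rabs_pos.
    by have := hh t; have := Rle_abs C'; nra.
  by have := hK' t; have := Rabs_pos C'; nra.
Qed.

Lemma decaying_smooth_bounded gens :
  (forall f, List.In f gens -> has_derivative_in (poly_in gens) f) ->
  (forall f, List.In f gens -> forall t, Rabs (f t) <= L t) ->
  List.In v gens ->
  forall f, decaying gens f -> smooth f /\ forall n, bounded_fun (Derive_n f n).
Proof.
move=> gens_derive gens_le_L gens_v; apply: smooth_bounded_of_stable.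
- exact: decaying_derive.
- exact: decaying_bounded.
Qed.

(** * The scalar equation *)

(** The power L^(1/l) with l = m + 1. *)
Definition A (m : nat) (t : R) : R := exp (ln (L t) / INR m.+1).

Lemma A_pow m t : A m t ^ m.+1 = L t.
Proof.
rewrite /A -exp_nat_mul.
have -> : INR m.+1 * (ln (L t) / INR m.+1) = ln (L t).
  by field; apply: not_0_INR.
by apply: exp_ln; have := L_ge1 t; lra.
Qed.

Lemma A_bounds m t : 1 <= A m t <= L t.
Proof.
have A1 : 1 <= A m t.
  apply: (Rle_trans _ (1 + ln (L t) / INR m.+1)); last exact: exp_ineq1_le.
  suff : 0 <= ln (L t) / INR m.+1 by lra.
  apply: Rdiv_le_0_compat; last by apply: lt_0_INR; lia.
  by rewrite -ln_1; apply: ln_le; [lra|apply: L_ge1].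
split=> //.
by rewrite -(A_pow m t) /=; have := pow_R1_Rle (A m t) m A1; nra.
Qed.

Lemma is_derive_A m t : is_derive (A m) t (2 / INR m.+1 * A m t * / L t * v t).
Proof.
have L1 := L_ge1 t; have m0 : INR m.+1 <> 0 by apply: not_0_INR.
rewrite /A; move: m0; set l := INR m.+1 => m0; auto_derive.
  by split; [exists (2 * v t); apply: is_derive_L|split=> //; lra].
rewrite (is_derive_unique _ _ _ (is_derive_L t)).
by rewrite /Rdiv; ring.
Qed.

(** The lower energy bound at every time, including those at which L is still
    close to 1, is what the constant 3 in L is for: it gives L >= 1 and v^2 <= 1/12, so that (A' X)^2 <= 1/(3 l^2) <= 1/(6 l) for
    l >= 2. *)
Lemma slowly_growing_oscillation (m : nat) (hm : (0 < m)%N) :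
  exists beta q p : R -> R,
    [/\ smooth beta /\ (forall n, bounded_fun (Derive_n beta n)),
        forall t, is_derive q t (p t),
        forall t, is_derive p t (beta t - q t ^ (2 * m).+1),
        forall K, exists t, K < q t
      & forall t, L t ^ 2 / (6 * INR m.+1)
                  <= p t ^ 2 / 2 + q t ^ (2 * m.+1) / (2 * INR m.+1)
                  <= 2 * L t ^ 2].
Proof.
have [x [y [dx dy energy peak]]] := oscillator m.
set l := INR m.+1 in energy *.
have l2 : 2 <= l by rewrite /l -[2]/(INR 2); apply: le_INR; move/leP: hm; lia.
have even0 z : 0 <= z ^ (2 * m.+1).
  by rewrite pow_muln; apply: pow_le; apply: pow2_ge_0.
have Al t : A m t * A m t ^ m = L t by apply: A_pow.
have am1 t : 1 <= A m t ^ m by apply: pow_R1_Rle; case: (A_bounds m t).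
(* rescaled time: at amplitude A the oscillator runs A^m times faster *)
pose Th t := RInt (fun s => A m s ^ m) 0 t.
have dTh t : is_derive Th t (A m t ^ m).
  apply: is_derive_antiderivative => s.
  apply: (ex_derive_continuous (V := R_NormedModule)).
  by apply: ex_derive_pow; eexists; apply: is_derive_A.
pose X t := x (Th t); pose Y t := y (Th t).
have dX t : is_derive X t (A m t ^ m * Y t).
  by rewrite /X; apply: (is_derive_comp x Th).
have dY t : is_derive Y t (A m t ^ m * - X t ^ (2 * m).+1).
  by rewrite /Y; apply: (is_derive_comp y Th).
pose gens := [:: A m; (fun t => / L t); u; v; X; Y].
have gA : poly_in gens (A m) by apply: poly_in_gen; rewrite /=; tauto.
have gM : poly_in gens (fun t => / L t) by apply: poly_in_gen; rewrite /=; tauto.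
have gu : poly_in gens u by apply: poly_in_gen; rewrite /=; tauto.
have gv : poly_in gens v by apply: poly_in_gen; rewrite /=; tauto.
have gX : poly_in gens X by apply: poly_in_gen; rewrite /=; tauto.
have gY : poly_in gens Y by apply: poly_in_gen; rewrite /=; tauto.
have gens_derive f : List.In f gens -> has_derivative_in (poly_in gens) f.
  case=> [<-|[<-|[<-|[<-|[<-|[<-|[]]]]]]].
  - exists (fun t => 2 / l * A m t * / L t * v t); last by apply: is_derive_A.
    by repeat first [assumption|apply: poly_in_const|apply: poly_in_mul].
  - exists (fun t => - (2) * v t * / L t * / L t).
      by repeat first [assumption|apply: poly_in_const|apply: poly_in_mul].
    move=> t; have L1 := L_ge1 t; auto_derive.
      by split; [exists (2 * v t); apply: is_derive_L|split=> //; lra].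
    by rewrite (is_derive_unique _ _ _ (is_derive_L t)); field; lra.
  - exists (fun t => - (2) * u t * v t); last by apply: is_derive_u.
    by repeat first [assumption|apply: poly_in_const|apply: poly_in_mul].
  - exists (fun t => u t + - (2) * v t * v t); last by apply: is_derive_v.
    by repeat first [assumption|apply: poly_in_const|apply: poly_in_add|apply: poly_in_mul].
  - exists (fun t => A m t ^ m * Y t) => //.
    by apply: poly_in_mul => //; apply: poly_in_pow.
  - exists (fun t => A m t ^ m * (-1 * X t ^ (2 * m).+1)).
      apply: poly_in_mul; first exact: poly_in_pow.
      by apply: poly_in_mul; [apply: poly_in_const|apply: poly_in_pow].
    by move=> t; replace (-1 * X t ^ (2 * m).+1) with (- X t ^ (2 * m).+1) by ring.
have XY t : Y t ^ 2 + X t ^ (2 * m.+1) / l = / l by apply: energy.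
have invl : / l <= / 2 by apply: Rinv_le_contravar; lra.
have invl0 : 0 < / l by apply: Rinv_0_lt_compat; lra.
have Y1 t : Rabs (Y t) <= 1.
  have := XY t; rewrite -(pow2_abs (Y t)); have := Rabs_pos (Y t).
  have : 0 <= X t ^ (2 * m.+1) / l by apply: Rmult_le_pos => //; lra.
  by nra.
have X1 t : Rabs (X t) <= 1.
  case: (Rle_lt_dec (Rabs (X t)) 1) => // X1.
  have sq1 : 1 < X t ^ 2 by rewrite -pow2_abs; nra.
  have := Rlt_pow_R1 (X t ^ 2) m.+1 sq1 ltac:(lia).
  rewrite -pow_muln => big1.
  have : 1 * / l < X t ^ (2 * m.+1) / l by apply: Rmult_lt_compat_r.
  by have := XY t; have := pow2_ge_0 (Y t); lra.
have gens_le f : List.In f gens -> forall t, Rabs (f t) <= L t.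
  move=> hf t; have L1 := L_ge1 t; move: hf.
  case=> [<-|[<-|[<-|[<-|[<-|[<-|[]]]]]]].
  - by have := A_bounds m t => h; rewrite Rabs_pos_eq; lra.
  - have L0 : 0 < / L t by apply: Rinv_0_lt_compat; lra.
    have L2 : / L t <= / 1 by apply: Rinv_le_contravar; lra.
    by rewrite Rabs_pos_eq; lra.
  - by have := u_bounds t => h; rewrite Rabs_pos_eq; lra.
  - have := v_sq t; rewrite -(pow2_abs (v t)); have := Rabs_pos (v t); nra.
  - by have := X1 t; lra.
  - by have := Y1 t; lra.
have gens_v : List.In v gens by rewrite /=; tauto.
pose A' t := 2 / l * A m t * / L t * v t.
have decA' : decaying gens A'.
  exists (fun=> 0), (fun t => 2 / l * A m t * / L t); split.
  - exact: poly_in_const.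
  - by repeat first [assumption|apply: poly_in_const|apply: poly_in_mul].
  - by move=> t; rewrite /A'; ring.
have [A2 decA2 dA'] := decaying_derive gens gens_derive gens_v A' decA'.
(* the part of (A X)'' that contains a derivative of A *)
pose beta t := A2 t * X t + A' t * (INR m.+2 * A m t ^ m * Y t).
exists beta, (fun t => A m t * X t), (fun t => A' t * X t + L t * Y t).
have dA t : is_derive (A m) t (A' t) by apply: is_derive_A.
split.
- apply: (decaying_smooth_bounded gens) => //.
  apply: decaying_add; apply: decaying_poly => //.
  apply: poly_in_mul => //; apply: poly_in_mul; first exact: poly_in_const.
  exact: poly_in_pow.
- move=> t; rewrite -(Al t).
  replace (A' t * X t + A m t * A m t ^ m * Y t)
    with (A' t * X t + A m t * (A m t ^ m * Y t)) by ring.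
  exact: is_derive_mul.
- move=> t.
  have dL : is_derive L t (l * A' t * A m t ^ m).
    apply: (is_derive_ext (fun s => A m s ^ m.+1)) => [s|]; first exact: A_pow.
    exact: (is_derive_pow (A m) m.+1).
  have -> : beta t - (A m t * X t) ^ (2 * m).+1 =
    (A2 t * X t + A' t * (A m t ^ m * Y t)) +
    (l * A' t * A m t ^ m * Y t + L t * (A m t ^ m * - X t ^ (2 * m).+1)).
    rewrite Rpow_mult_distr /beta (S_INR m.+1) -/l.
    have -> : A m t ^ (2 * m).+1 = A m t * A m t ^ m * A m t ^ m.
      by rewrite -tech_pow_Rmult mul2n -addnn pow_add; ring.
    by rewrite Al; ring.
  by apply: is_derive_add; apply: is_derive_mul.
- move=> K.
  (* T is chosen so that L > B^l, hence A > B, at all times after T; then take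
     a later time at which X = 1. *)
  have K0 := Rabs_pos K; have K1 := Rle_abs K.
  pose B := Rabs K + 1; pose T := exp (B ^ m.+1).
  have Thmono a b : a <= b -> Th a <= Th b.
    move=> hab; have [c] := mean_value Th _ dTh a b hab.
    by have := am1 c; nra.
  have [Thinv [ThK _]] := expanding_inverse Th _ dTh am1.
  have [s hs xs] := peak (Th T).
  have T0 : 0 < T by apply: exp_pos.
  have Tt : T < Thinv s.
    case: (Rle_lt_dec (Thinv s) T) => // /Thmono; rewrite ThK; lra.
  exists (Thinv s); rewrite /X ThK xs Rmult_1_r.
  case: (Rle_lt_dec B (A m (Thinv s))) => [|AB]; first by rewrite /B; lra.
  have A1 := A_bounds m (Thinv s).
  have : A m (Thinv s) ^ m.+1 <= B ^ m.+1 by apply: pow_incr; lra.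
  rewrite A_pow -(ln_exp (B ^ m.+1)) -/T /L => /Rle_not_lt []; apply: ln_increasing => //.
  by nra.
- move=> t.
  have L1 := L_ge1 t.
  have -> : (A m t * X t) ^ (2 * m.+1) / (2 * l) = L t ^ 2 * (/ l - Y t ^ 2) / 2.
    rewrite Rpow_mult_distr [in A m t ^ _]mulnC pow_muln A_pow -(XY t).
    by field; lra.
  have w2 : (A' t * X t) ^ 2 <= / l * / 6.
    have -> : (A' t * X t) ^ 2 = 4 * (/ l * / l) * (A m t * / L t) ^ 2 * v t ^ 2 * X t ^ 2.
      by rewrite /A'; field; lra.
    have q1 : (A m t * / L t) ^ 2 <= 1.
      have h := A_bounds m t.
      have i0 : 0 < / L t by apply: Rinv_0_lt_compat; lra.
      have i1 : L t * / L t = 1 by field; lra.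
      have i2 : A m t * / L t <= 1 by nra.
      have i3 : 0 <= A m t * / L t by nra.
      by nra.
    have q2 := v_sq t.
    have q3 : X t ^ 2 <= 1 by have := X1 t; rewrite -pow2_abs; have := Rabs_pos (X t); nra.
    have q4 : (A m t * / L t) ^ 2 * v t ^ 2 <= 1 * / 12.
      by apply: Rmult_le_compat => //; apply: pow2_ge_0.
    have q5 : (A m t * / L t) ^ 2 * v t ^ 2 * X t ^ 2 <= 1 * / 12 * 1.
      apply: Rmult_le_compat => //; last exact: pow2_ge_0.
      by apply: Rmult_le_pos; apply: pow2_ge_0.
    by nra.
  have hY : Y t ^ 2 <= / l.
    have : 0 <= X t ^ (2 * m.+1) / l by apply: Rmult_le_pos => //; lra.
    by have := XY t; lra.
  have -> : L t ^ 2 / (6 * l) = L t ^ 2 * / l / 6 by field; lra.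
  set w := A' t * X t in w2 *.
  have hLY : 0 <= L t ^ 2 * Y t ^ 2 <= L t ^ 2 * / l.
    by split; [apply: Rmult_le_pos|apply: Rmult_le_compat_l => //]; apply: pow2_ge_0.
  have sqL1 : 1 <= L t ^ 2 by nra.
  have hL : / l <= L t ^ 2 * / l by nra.
  have hL2 : L t ^ 2 * / l <= L t ^ 2 * / 2.
    by apply: Rmult_le_compat_l => //; apply: pow2_ge_0.
  (* (w + L Y)^2 <= 2 w^2 + 2 L^2 Y^2 and (w + L Y)^2 >= L^2 Y^2 / 2 - w^2 *)
  by have := pow2_ge_0 (w - L t * Y t); have := pow2_ge_0 (2 * w + L t * Y t); split; nra.
Qed.

(** * The system *)

Lemma sum_supported_at_0 (d : nat) (F : 'I_d.+1 -> R) :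
  (forall j, nat_of_ord j <> 0%N -> F j = 0) -> \big[Rplus/0]_(j < d.+1) F j = F ord0.
Proof.
move=> hF; rewrite big_ord_recl; set tail := (X in _ + X).
have -> : tail = 0; last exact: Rplus_0_r.
apply: (big_ind (fun r => r = 0)) => [//|a b -> ->|j _]; first exact: Rplus_0_r.
exact: hF.
Qed.

(** For t >= 0 one has 2 + t <= 3 + t^2 <= (2 + t)^2. *)
Lemma ln_bounds t : 0 <= t -> ln (2 + t) <= L t <= 2 * ln (2 + t).
Proof.
move=> t0; split; first by apply: ln_le; nra.
have -> : 2 * ln (2 + t) = ln ((2 + t) * (2 + t)) by rewrite ln_mult; lra.
by apply: ln_le; nra.
Qed.

Theorem proposition4p1 (d l : nat) (hd : (1 <= d)%N) (hl : (2 <= l)%N) :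
  exists beta : R -> R,
    smooth beta /\
    (forall n : nat, bounded_fun (Derive_n beta n)) /\
    exists q : R -> 'I_d -> R,
      solution l beta q /\
      unbounded q /\
      exists C1 C2 : R,
        0 < C1 /\ 0 < C2 /\
        forall t : R, 0 <= t ->
          C1 * ln (2 + t) ^ 2 <= E l (q t) (velocity q t) /\
          E l (q t) (velocity q t) <= C2 * ln (2 + t) ^ 2.
Proof.
case: d hd => // d _; case: l hl => // m hm.
have [beta [q [p [[sb bb] dq dp qbig energy]]]] := slowly_growing_oscillation m hm.
exists beta; split=> //; split=> //.
pose Q t (j : 'I_d.+1) := if nat_of_ord j is O then q t else 0.
have VQ t j : velocity Q t j = if nat_of_ord j is O then p t else 0.
  case: j => -[|j] hj; rewrite /velocity /Q /=; last exact: Derive_const.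
  exact: is_derive_unique.
exists Q; split; [|split].
- move=> [[|j] hj] t; rewrite /Q /=; split.
  + by exists (p t).
  + apply: (ex_derive_ext p) => [s|]; last by exists (beta t - q t ^ (2 * m).+1).
    by rewrite (is_derive_unique _ _ _ (dq s)).
  + rewrite (Derive_ext _ p) => [|s]; last exact: is_derive_unique.
    rewrite (is_derive_unique _ _ _ (dp t)) mulnS subSS subn0; ring.
  + exact: ex_derive_const.
  + apply: (ex_derive_ext (fun=> 0)) => [s|]; last exact: ex_derive_const.
    by rewrite Derive_const.
  + rewrite (Derive_ext _ (fun=> 0)) => [|s]; last exact: Derive_const.
    by rewrite Derive_const mulnS subSS subn0 /=; ring.
- case=> M hM; have [t ht] := qbig M.
  have := hM t; rewrite /Defs.norm /sqnorm sum_supported_at_0.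
    rewrite /Q /= -/(q t ^ 2) -Rsqr_pow2 sqrt_Rsqr_abs.
    by have := Rle_abs (q t); lra.
  by move=> j j0; rewrite /Q; case: (nat_of_ord j) j0 => //= k _; ring.
- have l0 : 0 < INR m.+1 by apply: lt_0_INR; lia.
  exists (/ (6 * INR m.+1)), 8; split; first by apply: Rinv_0_lt_compat; lra.
  split; first lra.
  move=> t t0.
  have -> : E m.+1 (Q t) (velocity Q t)
            = p t ^ 2 / 2 + q t ^ (2 * m.+1) / (2 * INR m.+1).
    rewrite /E /W /sqnorm !sum_supported_at_0.
    + rewrite VQ; have -> : Q t ord0 = q t by [].
      by have -> : nat_of_ord (@ord0 d) = 0%N by []; field; lra.
    + by move=> j j0; rewrite /Q; case: (nat_of_ord j) j0 => //= k _; ring.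
    + by move=> j j0; rewrite VQ; case: (nat_of_ord j) j0 => //= k _; ring.
  have [e1 e2] := energy t; have [b1 b2] := ln_bounds t t0.
  have ln0 : 0 <= ln (2 + t) by rewrite -ln_1; apply: ln_le; lra.
  have i0 : 0 < / (6 * INR m.+1) by apply: Rinv_0_lt_compat; lra.
  split.
  + by apply: Rle_trans e1; rewrite Rmult_comm; apply: Rmult_le_compat_r; [lra|nra].
  + by apply: Rle_trans e2 _; nra.
Qed.
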